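(* Let $M$ be a matroid with at least two elements. Then $M$ is $U_{0,1} \oplus U_{1,1}$-connected if and only if every clonal class of $M$ is trivial.
   Context: A matroid $M$ with $|E(M)| \geq 2$ is $N$-connected if for every pair of distinct elements $e,f \in E(M)$ there is a minor of $M$ isomorphic to $N$ whose ground set contains $\{e,f\}$. Elements $x,y$ of $M$ are clones if the bijection of $E(M)$ interchanging $x$ and $y$ and fixing all other elements is an automorphism of $M$; the clone relation is an equivalence relation whose classes are the clonal classes, and a clonal class is trivial if it has a single element. *)

(* Defs.v *)
From mathcomp Require Import all_boot all_fingroup.
Set Implicit Arguments.
Unset Strict Implicit.
Unset Printing Implicit Defensive.

(* The carrier [T] is an ambient finite type; the ground set is a subset of it,
   so that all minors of a matroid on [T] are again matroids on [T]. *)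
Record matroid (T : finType) := Matroid {
  ground : {set T};
  indep : {set {set T}};
  indep_ground : forall I : {set T}, I \in indep -> I \subset ground;
  indep_set0 : set0 \in indep;
  indep_subset : forall I J : {set T}, J \in indep -> I \subset J -> I \in indep;
  indep_augment : forall I J : {set T},
    I \in indep -> J \in indep -> #|I| < #|J| ->
    exists2 x, x \in J :\: I & x |: I \in indep
}.

Section Minors.
Variables (T : finType) (M : matroid T).
Implicit Types (A B C D I J X : {set T}).

Definition basis_in X B :=
  maxset (fun I => (I \in indep M) && (I \subset X)) B.

Lemma basis_inP X B : basis_in X B ->
  [/\ B \in indep M, B \subset X
    & forall x, x \in X -> x |: B \in indep M -> x \in B].
Proof.
case/maxsetP=> /andP[iB sB] maxB; split=> // x xX ixB.
rewrite -(maxB (x |: B)) ?setU11 ?subsetUr // ixB /=.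
by rewrite subUset sub1set xX.
Qed.

Lemma basis_in_exists X : exists B, basis_in X B.
Proof.
have [|B mB _] :=
  @maxset_exists _ (fun I => (I \in indep M) && (I \subset X)) set0.
  by rewrite indep_set0 sub0set.
by exists B.
Qed.

Definition delete_indep D := [set I in indep M | I \subset ground M :\: D].

Fact delete_indep_ground D I :
  I \in delete_indep D -> I \subset ground M :\: D.
Proof. by rewrite inE => /andP[]. Qed.

Fact delete_indep_set0 D : set0 \in delete_indep D.
Proof. by rewrite inE indep_set0 sub0set. Qed.

Fact delete_indep_subset D I J :
  J \in delete_indep D -> I \subset J -> I \in delete_indep D.
Proof.
rewrite !inE => /andP[iJ sJ] sIJ.
by rewrite (indep_subset iJ sIJ) (subset_trans sIJ sJ).
Qed.

Fact delete_indep_augment D I J :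
  I \in delete_indep D -> J \in delete_indep D -> #|I| < #|J| ->
  exists2 x, x \in J :\: I & x |: I \in delete_indep D.
Proof.
rewrite !inE => /andP[iI sI] /andP[iJ sJ] ltIJ.
have [x xJI ixI] := indep_augment iI iJ ltIJ; exists x => //.
rewrite inE ixI subUset sI sub1set andbT (subsetP sJ) //.
by case/setDP: xJI.
Qed.

Definition delete D : matroid T :=
  Matroid (@delete_indep_ground D) (delete_indep_set0 D)
    (@delete_indep_subset D) (@delete_indep_augment D).

(* The independent sets of M / C are the I contained in E(M) - C such that
   I :|: B is independent for some basis B of the restriction of M to C;
   by [contract_indepP] the choice of B is immaterial. *)
Definition contract_indep C :=
  [set I : {set T} | (I \subset ground M :\: C) &&
     [exists B, basis_in C B && (I :|: B \in indep M)]].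

Lemma contract_indepP C B I : basis_in C B ->
  (I \in contract_indep C) =
    (I \subset ground M :\: C) && (I :|: B \in indep M).
Proof.
move=> bB; rewrite inE; have [sI /=|//] := boolP (I \subset _).
apply/existsP/idP=> [[B0 /andP[bB0 iIB0]]|iIB]; last by exists B; rewrite bB.
have [iB sB maxB] := basis_inP bB; have [iB0 sB0 _] := basis_inP bB0.
pose P J := (B \subset J) && (J \subset I :|: B) && (J \in indep M).
have [|J /maxsetP[/andP[/andP[sBJ sJ] iJ] maxJ] _] := @maxset_exists _ P B.
  by rewrite /P subxx subsetUr iB.
suff leJ : #|I :|: B| <= #|J|.
  by have /eqP<- : J == I :|: B by rewrite eqEcard sJ leJ.
have dis X : X \subset C -> #|I :|: X| = #|I| + #|X|.
  move=> sX; rewrite cardsU; suff -> : I :&: X = set0 by rewrite cards0 subn0.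
  apply/setP=> x; rewrite !inE; apply/negP=> /andP[xI xX].
  by have /setDP[_ /negP] := subsetP sI x xI; apply; apply: (subsetP sX).
have leB : #|B| <= #|B0|.
  rewrite leqNgt; apply/negP=> lt.
  have [_ _ maxB0] := basis_inP bB0.
  have [x /setDP[xB xB0] ix] := indep_augment iB0 iB lt.
  by case/negP: xB0; apply: maxB0 => //; apply: (subsetP sB).
apply: (@leq_trans #|I :|: B0|); first by rewrite !dis // leq_add2l.
rewrite leqNgt; apply/negP=> lt.
have [x /setDP[xIB0 xJ] ixJ] := indep_augment iJ iIB0 lt.
have /setUP[xI|xB0] := xIB0; last first.
  case/negP: xJ; apply: (subsetP sBJ); apply: maxB; first exact: (subsetP sB0).
  by apply: indep_subset ixJ _; rewrite setUS.
case/negP: xJ; rewrite -(maxJ (x |: J)) ?setU11 ?subsetUr //.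
rewrite /P ixJ andbT subUset sub1set inE xI sJ !andbT.
exact: subset_trans sBJ (subsetUr _ _).
Qed.

Fact contract_indep_ground C I :
  I \in contract_indep C -> I \subset ground M :\: C.
Proof. by rewrite inE => /andP[]. Qed.

Fact contract_indep_set0 C : set0 \in contract_indep C.
Proof.
have [B bB] := basis_in_exists C; have [iB _ _] := basis_inP bB.
by rewrite (contract_indepP _ bB) sub0set set0U.
Qed.

Fact contract_indep_subset C I J :
  J \in contract_indep C -> I \subset J -> I \in contract_indep C.
Proof.
have [B bB] := basis_in_exists C; rewrite !(contract_indepP _ bB).
move=> /andP[sJ iJ] sIJ; rewrite (subset_trans sIJ sJ) /=.
by apply: indep_subset iJ _; rewrite setSU.
Qed.

Fact contract_indep_augment C I J :
  I \in contract_indep C -> J \in contract_indep C -> #|I| < #|J| ->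
  exists2 x, x \in J :\: I & x |: I \in contract_indep C.
Proof.
have [B bB] := basis_in_exists C; have [_ sB _] := basis_inP bB.
rewrite !(contract_indepP _ bB) => /andP[sI iI] /andP[sJ iJ] ltIJ.
have dis X : X \subset ground M :\: C -> #|X :|: B| = #|X| + #|B|.
  move=> sX; rewrite cardsU; suff -> : X :&: B = set0 by rewrite cards0 subn0.
  apply/setP=> x; rewrite !inE; apply/negP=> /andP[xX xB].
  by have /setDP[_ /negP] := subsetP sX x xX; apply; apply: (subsetP sB).
have [|x /setDP[]] := indep_augment iI iJ; first by rewrite !dis // ltn_add2r.
rewrite !inE negb_or => xJB /andP[xI xB] ix.
move: xJB; rewrite (negPf xB) orbF => xJ; exists x; first by rewrite !inE xI.
by rewrite (contract_indepP _ bB) subUset sub1set (subsetP sJ) // sI -setUA.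
Qed.

Definition contract C : matroid T :=
  Matroid (@contract_indep_ground C) (contract_indep_set0 C)
    (@contract_indep_subset C) (@contract_indep_augment C).

End Minors.

Definition is_minor (T : finType) (M' M : matroid T) : Prop :=
  exists C D : {set T},
    [/\ C \subset ground M, D \subset ground M, [disjoint C & D]
      & M' = delete (contract M C) D].

Section Uniform.
Variables r n : nat.

Implicit Types I J : {set 'I_n}.

Definition uniform_indep := [set I : {set 'I_n} | #|I| <= r].

Fact uniform_indep_ground I : I \in uniform_indep -> I \subset [set: 'I_n].
Proof. by rewrite subsetT. Qed.

Fact uniform_indep_set0 : set0 \in uniform_indep.
Proof. by rewrite inE cards0. Qed.

Fact uniform_indep_subset I J :
  J \in uniform_indep -> I \subset J -> I \in uniform_indep.
Proof. by rewrite !inE => leJ /subset_leq_card/leq_trans; apply. Qed.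

Fact uniform_indep_augment I J :
  I \in uniform_indep -> J \in uniform_indep -> #|I| < #|J| ->
  exists2 x, x \in J :\: I & x |: I \in uniform_indep.
Proof.
rewrite !inE => _ leJ ltIJ.
have /subsetPn[x xJ xI] : ~~ (J \subset I).
  by apply: contraL ltIJ => /subset_leq_card; rewrite -leqNgt.
by exists x; rewrite ?inE ?xI // cardsU1 xI (leq_trans _ leJ).
Qed.

Definition uniform : matroid 'I_n :=
  Matroid uniform_indep_ground uniform_indep_set0
    uniform_indep_subset uniform_indep_augment.

End Uniform.

Section DirectSum.
Variables (T1 T2 : finType) (M1 : matroid T1) (M2 : matroid T2).
Implicit Types I J : {set T1 + T2}.

Definition sum_ground : {set T1 + T2} :=
  [set x | match x with inl a => a \in ground M1 | inr b => b \in ground M2 end].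

Definition sum_indep : {set {set T1 + T2}} :=
  [set I : {set T1 + T2} |
    (inl @^-1: I \in indep M1) && (inr @^-1: I \in indep M2)].

Fact sum_indep_ground I : I \in sum_indep -> I \subset sum_ground.
Proof.
rewrite inE => /andP[/indep_ground/subsetP s1 /indep_ground/subsetP s2].
by apply/subsetP=> -[a|b] xI; rewrite inE; [apply: s1|apply: s2]; rewrite inE.
Qed.

Fact sum_indep_set0 : set0 \in sum_indep.
Proof. by rewrite inE !preimset0 !indep_set0. Qed.

Fact sum_indep_subset I J : J \in sum_indep -> I \subset J -> I \in sum_indep.
Proof.
rewrite !inE => /andP[i1 i2] sIJ.
by rewrite (indep_subset i1) ?(indep_subset i2) ?preimsetS.
Qed.

Lemma card_sum_set I : #|I| = #|inl @^-1: I| + #|inr @^-1: I|.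
Proof.
rewrite -!sum1_card big_sumType /=.
by congr (_ + _); apply: eq_bigl => x; rewrite inE.
Qed.

Fact sum_indep_augment I J :
  I \in sum_indep -> J \in sum_indep -> #|I| < #|J| ->
  exists2 x, x \in J :\: I & x |: I \in sum_indep.
Proof.
rewrite !inE => /andP[iI1 iI2] /andP[iJ1 iJ2] ltIJ.
have [lt1|ge1] := ltnP #|inl @^-1: I| #|inl @^-1: J|.
  have [a aJI iaI] := indep_augment iI1 iJ1 lt1.
  exists (inl a); first by move: aJI; rewrite !inE.
  rewrite inE; apply/andP; split.
    by rewrite (_ : _ @^-1: _ = a |: inl @^-1: I) //; apply/setP=> z; rewrite !inE.
  by rewrite (_ : _ @^-1: _ = inr @^-1: I) //; apply/setP=> z; rewrite !inE.
have lt2 : #|inr @^-1: I| < #|inr @^-1: J|.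
  move: ltIJ; rewrite !card_sum_set => lt; rewrite -(ltn_add2l #|inl @^-1: I|).
  by apply: leq_trans lt _; rewrite leq_add2r.
have [b bJI ibI] := indep_augment iI2 iJ2 lt2.
exists (inr b); first by move: bJI; rewrite !inE.
rewrite inE; apply/andP; split.
  by rewrite (_ : _ @^-1: _ = inl @^-1: I) //; apply/setP=> z; rewrite !inE.
by rewrite (_ : _ @^-1: _ = b |: inr @^-1: I) //; apply/setP=> z; rewrite !inE.
Qed.

Definition direct_sum : matroid (T1 + T2)%type :=
  Matroid sum_indep_ground sum_indep_set0 sum_indep_subset sum_indep_augment.

End DirectSum.

Definition elt (T : finType) (M : matroid T) := {x : T | x \in ground M}.

Definition preserves_indep (T T' : finType) (M : matroid T) (M' : matroid T')
    (f : elt M -> elt M') : bool :=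
  [forall X : {set elt M},
     ([set val x | x in X] \in indep M)
       == ([set val (f x) | x in X] \in indep M')].

Definition isomorphic (T T' : finType) (M : matroid T) (M' : matroid T') :
    Prop :=
  exists2 f : elt M -> elt M', bijective f & preserves_indep f.

Definition automorphism (T : finType) (M : matroid T) (s : {perm elt M}) :
    bool :=
  preserves_indep s.

Definition N_connected (T T' : finType) (N : matroid T') (M : matroid T) :
    Prop :=
  2 <= #|ground M| /\
  forall e f : T, e \in ground M -> f \in ground M -> e != f ->
    exists M' : matroid T,
      [/\ is_minor M' M, isomorphic M' N & [set e; f] \subset ground M'].

Definition clones (T : finType) (M : matroid T) : rel (elt M) :=
  fun x y => automorphism (tperm x y).

Lemma clones_equivalence (T : finType) (M : matroid T) :
  equivalence_rel (@clones T M).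
Proof.
have autM (s t : {perm elt M}) :
    automorphism s -> automorphism t -> automorphism (s * t)%g.
  move=> /forallP As /forallP At; apply/forallP=> X.
  rewrite (eqP (As X)); have /eqP := At (s @: X).
  rewrite -[[set val x | x in s @: X]]imset_comp.
  rewrite -[[set val (t x) | x in s @: X]]imset_comp => ->.
  apply/eqP; congr (in_mem _ _); apply: eq_imset => x /=.
  by rewrite permM.
have clxx (x : elt M) : clones x x.
  rewrite /clones tperm1; apply/forallP=> X; apply/eqP; congr (in_mem _ _).
  by apply: eq_imset => z; rewrite perm1.
have clC (x y : elt M) : clones x y = clones y x by rewrite /clones tpermC.
have clT (x y z : elt M) : clones x y -> clones y z -> clones x z.
  move=> cxy cyz; have [->//|nxz] := eqVneq x z.
  have [exy|nxy] := eqVneq x y; first by rewrite exy.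
  have [eyz|nyz] := eqVneq y z; first by rewrite -eyz.
  rewrite /clones; have <- : (tperm y z ^ tperm x y = tperm x z)%g.
    by rewrite tpermJ tpermR tpermD // eq_sym.
  rewrite /conjg tpermV.
  by apply: (autM _ _ cxy); apply: autM.
move=> x y z; split=> // cxy; apply/idP/idP; last exact: clT.
by apply: clT; rewrite clC.
Qed.

Definition clonal_classes (T : finType) (M : matroid T) : {set {set elt M}} :=
  equivalence_partition (@clones T M) [set: elt M].

(* Main.v *)
Require Import Defs.
From mathcomp Require Import all_boot all_fingroup.

(** Two elements [x], [y] fail to be clones exactly when some [X] avoiding both
    has precisely one of [X + x], [X + y] independent.  Contracting such an [X]
    and deleting everything else but [x] and [y] leaves a loop and a coloop;
    conversely a minor on [{x, y}] that consists of a loop and a coloop yields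
    such an [X], namely a basis of the contracted set. *)

Lemma mem_imset_tperm (T : finType) (x y z : T) (A : {set T}) :
  (z \in tperm x y @: A) = (tperm x y z \in A).
Proof. by rewrite -{1}(tpermK x y z) mem_imset //; apply: perm_inj. Qed.

Lemma imset_tperm_id (T : finType) (x y : T) (A : {set T}) :
  (x \in A) = (y \in A) -> tperm x y @: A = A.
Proof.
by move=> exy; apply/setP=> z; rewrite mem_imset_tperm; case: tpermP => [->|->|].
Qed.

Lemma imset_tperm_swap (T : finType) (x y : T) (A : {set T}) :
  x \notin A -> y \notin A -> tperm x y @: (x |: A) = y |: A.
Proof.
move=> xA yA; apply/setP=> z; rewrite mem_imset_tperm !inE.
case: tpermP => [->|->|/eqP/negPf zx /eqP/negPf zy].
- by rewrite (negPf xA) (negPf yA) !orbF eq_sym.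
- by rewrite !eqxx.
- by rewrite zx zy.
Qed.

(** The transposition fixes every set containing both or neither of [x], [y], so only sets of the
    form [X] plus one of them can be a test. *)
Lemma clonesP (T : finType) (M : matroid T) (x y : elt M) :
  reflect (forall X : {set T}, val x \notin X -> val y \notin X ->
             (val x |: X \in indep M) = (val y |: X \in indep M))
          (clones x y).
Proof.
have imE (Y : {set elt M}) :
    [set val (tperm x y z) | z in Y] = val @: (tperm x y @: Y).
  by rewrite -imset_comp.
apply: (iffP forallP) => [cxy X xX yX | indE Y].
  (* [X] ranges over the ambient type; when it leaves the ground set, both sides are dependent. *)
  have [/subsetP sX|nsX] := boolP (X \subset ground M); last first.
    by apply/idP/idP=> /indep_ground; rewrite subUset (negPf nsX) andbF.
  pose Y := [set z : elt M | val z \in X].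
  have <- : val @: Y = X.
    apply/setP=> z; apply/imsetP/idP => [[u]|zX]; first by rewrite inE => ? ->.
    by exists (Sub z (sX z zX)); rewrite ?inE SubK.
  have := eqP (cxy (x |: Y)).
  by rewrite imE imset_tperm_swap ?inE // !imsetU1.
apply/eqP; rewrite imE.
(* Stated for generic [u], [v] so that it serves both when only [x] and when only [y] lies in [Y];
   the relevant [X] is the image of [Y] without [u]. *)
have swap (u v : elt M) : u \in Y -> v \notin Y ->
    (forall X : {set T}, val u \notin X -> val v \notin X ->
       (val u |: X \in indep M) = (val v |: X \in indep M)) ->
    (val @: Y \in indep M) = (val @: (tperm u v @: Y) \in indep M).
  move=> uY vY indY; rewrite -(setD1K uY) imset_tperm_swap ?setD11 //; last first.
    by rewrite !inE (negPf vY) andbF.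
  rewrite !imsetU1; apply: indY; rewrite (mem_imset _ _ val_inj) !inE ?eqxx //.
  by rewrite (negPf vY) andbF.
have [exy|nexy] := eqVneq (x \in Y) (y \in Y); first by rewrite imset_tperm_id.
case xY: (x \in Y) nexy; case yY: (y \in Y) => // _.
  by apply: swap => //; rewrite yY.
by rewrite tpermC; apply: swap; rewrite ?xY // => X yX xX; rewrite indE.
Qed.

(** By reflexivity each class contains the element that defines it, so a class of size 1 contains
    nothing else. *)
Lemma clonal_classes_trivialP (T : finType) (M : matroid T) :
  (forall K : {set elt M}, K \in clonal_classes M -> #|K| = 1) <->
  (forall x y : elt M, clones x y -> x = y).
Proof.
have clxx (x : elt M) : clones x x by case: (clones_equivalence x x x).
split=> [triv x y cxy | cl_eq K /imsetP[x _ ->]].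
  have /eqP/cards1P[z Kz] : #|[set z in [set: elt M] | clones x z]| = 1.
    by apply: triv; apply: imset_f; rewrite inE.
  have [] : x \in [set z] /\ y \in [set z] by rewrite -Kz !inE clxx.
  by move=> /set1P-> /set1P->.
apply/eqP/cards1P; exists x; apply/setP=> z; rewrite !inE /=.
by apply/idP/eqP => [/cl_eq | ->].
Qed.

Local Notation loop_coloop :=
  (direct_sum (uniform 0 1) (uniform 1 1)) (only parsing).

(** The summand [uniform 1 1] is free, so the loop [inl ord0] is the only obstruction to
    independence. *)
Lemma indep_loop_coloop (I : {set 'I_1 + 'I_1}) :
  (I \in indep loop_coloop) = (inl ord0 \notin I).
Proof.
rewrite !inE leqn0 cards_eq0 (leq_trans (max_card _)) ?card_ord // andbT.
apply/eqP/idP=> [I0|nI].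
  by have := in_set0 (ord0 : 'I_1); rewrite -I0 inE => ->.
by apply/setP=> i; rewrite !inE (ord1 i) (negPf nI).
Qed.

Lemma card_loop_coloop : #|{: elt loop_coloop}| = 2.
Proof.
transitivity #|{: 'I_1 + 'I_1}|; last by rewrite card_sum !card_ord.
by rewrite card_sig; apply: eq_card => -[a|b]; rewrite !inE.
Qed.

(** The isomorphism forces two elements in all and sends [e], [f] to distinct ones, exactly one of
    which is the loop. *)
Lemma isomorphic_loop_coloop (T : finType) (M : matroid T) (e f : T) :
  e != f -> e \in ground M -> f \in ground M -> isomorphic M loop_coloop ->
  ground M = [set e; f] /\ ([set e] \in indep M) != ([set f] \in indep M).
Proof.
move=> nef eM fM [g bij_g /forallP pres_g]; split.
  apply/esym/eqP; rewrite eqEcard subUset !sub1set eM fM cards2 nef /=.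
  by rewrite -card_loop_coloop -(bij_eq_card bij_g) card_sig.
have indE z (zM : z \in ground M) :
    ([set z] \in indep M) = (val (g (Sub z zM)) != inl ord0).
  have := eqP (pres_g [set Sub z zM]).
  by rewrite !imset_set1 SubK indep_loop_coloop !inE eq_sym.
have : val (g (Sub e eM)) != val (g (Sub f fM)).
  by rewrite (inj_eq val_inj) (bij_eq bij_g) -(inj_eq val_inj) !SubK.
rewrite (indE e eM) (indE f fM).
by case: (val _) (val _) => [a|a] [b|b] //; rewrite ?(ord1 a) ?(ord1 b) ?eqxx.
Qed.

Lemma loop_coloop_isomorphic (T : finType) (M : matroid T) (e f : T) :
  e != f -> ground M = [set e; f] ->
  [set e] \in indep M -> [set f] \notin indep M ->
  isomorphic M loop_coloop.
Proof.
move=> nef gM ie nif.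
have lN : inl ord0 \in ground loop_coloop by rewrite !inE.
have rN : inr ord0 \in ground loop_coloop by rewrite !inE.
pose g (z : elt M) : elt loop_coloop :=
  (* The dependent element [f] must go to the loop, hence [e] to the coloop. *)
  if val z == f then Sub (inl ord0) lN else Sub (inr ord0) rN.
have gE z : (val (g z) == inl ord0) = (val z == f).
  by rewrite /g; case: ifP => _; rewrite SubK.
have eltE (z : elt M) : val z != f -> val z = e.
  have : val z \in [set e; f] by rewrite -gM; apply: valP.
  by rewrite !inE => /orP[/eqP//|->].
exists g.
  apply: inj_card_bij; last by rewrite card_loop_coloop card_sig gM cards2 nef.
  move=> u v guv; apply: val_inj; have := gE u; rewrite guv gE.
  case: (eqVneq (val v) f) => [-> /esym/eqP//|/eltE-> /esym/negbT].
  exact: eltE.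
apply/forallP=> X; rewrite indep_loop_coloop.
have -> : (inl ord0 \in [set val (g z) | z in X]) = (f \in val @: X).
  apply/imsetP/imsetP=> -[z zX Ez]; exists z => //; apply/esym/eqP.
    by rewrite -gE -Ez.
  by rewrite gE Ez.
(* A set containing [f] is dependent because [f] is a loop; a set avoiding [f] lies in [[set e]]. *)
apply/eqP; apply/idP/idP => [iX|fX].
  by apply: contra nif => fX; apply: indep_subset iX _; rewrite sub1set.
apply: indep_subset ie _; apply/subsetP=> _ /imsetP[z zX ->]; rewrite inE.
by apply/eqP/eltE; apply: contra fX => /eqP <-; apply: imset_f.
Qed.

(** Independence in a contraction can be tested with any one basis of [C], and deletion only
    restricts the ground set. *)
Lemma indep1_minor (T : finType) (M : matroid T) (C D B : {set T}) (z : T) :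
  basis_in M C B -> z \in ground (delete (contract M C) D) ->
  ([set z] \in indep (delete (contract M C) D)) = (z |: B \in indep M).
Proof.
move=> bB zM; rewrite inE sub1set zM andbT (contract_indepP _ bB) sub1set.
by case/setDP: zM => ->.
Qed.

Lemma basis_in_indep (T : finType) (M : matroid T) (X : {set T}) :
  X \in indep M -> basis_in M X X.
Proof.
move=> iX; apply/maxsetP; split=> [|Y /andP[_ sYX] sXY]; first by rewrite iX /=.
by apply/eqP; rewrite eqEsubset sYX.
Qed.

Lemma loop_coloop_minor (T : finType) (M : matroid T) (e f : T) (X : {set T}) :
  e != f -> e \in ground M -> f \in ground M -> e \notin X -> f \notin X ->
  e |: X \in indep M -> f |: X \notin indep M ->
  exists M' : matroid T,
    [/\ is_minor M' M, isomorphic M' loop_coloop & ground M' = [set e; f]].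
Proof.
move=> nef eM fM eX fX ieX nifX.
have iX : X \in indep M := indep_subset ieX (subsetUr _ _).
(* Being independent, [X] is its own basis, so adding [X] itself tests singletons in the
   contraction. *)
have sX := indep_ground iX; have bX := basis_in_indep _ _ _ iX.
pose D := ground M :\: (X :|: [set e; f]).
have gM' : ground (delete (contract M X) D) = [set e; f].
  apply/setP=> z; rewrite !inE.
  case: (eqVneq z e) => [->|_]; first by rewrite (negPf eX) eM.
  case: (eqVneq z f) => [->|_]; first by rewrite (negPf fX) fM orbT.
  by case: (z \in X); case: (z \in ground M).
exists (delete (contract M X) D); split=> //.
  exists X, D; split=> //; first exact: subsetDl.
  rewrite disjoints_subset; apply/subsetP=> z zX.
  by rewrite !inE zX.
by apply: (@loop_coloop_isomorphic _ _ e f) => //;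
  rewrite (indep1_minor _ _ _ _ _ _ bX) // gM' !inE eqxx ?orbT.
Qed.

Theorem theorem1p4 (T : finType) (M : matroid T) (hM : 2 <= #|ground M|) :
  N_connected (direct_sum (uniform 0 1) (uniform 1 1)) M <->
  (forall K : {set elt M}, K \in clonal_classes M -> #|K| = 1).
Proof.
apply: iff_trans (iff_sym (clonal_classes_trivialP _ M)).
split=> [[_ conn] x y cxy | cl_eq].
  apply/eqP/contraT; rewrite -(inj_eq val_inj) => nxy.
  have [M' [[C [D [_ _ _ ->]]] iso]] := conn _ _ (valP x) (valP y) nxy.
  rewrite subUset !sub1set => /andP[xM' yM'].
  have [_] := isomorphic_loop_coloop _ _ _ _ nxy xM' yM' iso.
  (* [B] lies in [C] and so avoids [x] and [y]; it is the set that contradicts [clonesP]. *)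
  have [B bB] := basis_in_exists M C; have [_ /subsetP sB _] := basis_inP bB.
  have notB z : z \in ground (delete (contract M C) D) -> z \notin B.
    by rewrite !inE => /and3P[_ zC _]; apply: contra zC; apply: sB.
  rewrite !(indep1_minor _ _ _ _ _ _ bB) //.
  by rewrite ((clonesP _ _ _ _ cxy) B) ?notB ?eqxx.
split=> // e f eM fM nef.
have : ~~ clones (Sub e eM : elt M) (Sub f fM).
  by apply: contra nef => /cl_eq/(congr1 val); rewrite !SubK => ->.
have [sep|no_sep] := boolP [exists X : {set T}, [&& e \notin X, f \notin X
    & (e |: X \in indep M) != (f |: X \in indep M)]]; last first.
  case/negP; apply/clonesP=> X; rewrite !SubK => eX fX; apply/eqP.
  by move/existsPn: no_sep => /(_ X); rewrite eX fX negbK.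
have [X /and3P[eX fX]] := existsP sep.
case iE: (e |: X \in indep M); case iF: (f |: X \in indep M) => // _ _.
  have [|M' [? ? gM']] := @loop_coloop_minor _ _ _ _ _ nef eM fM eX fX iE.
    by rewrite iF.
  by exists M'; rewrite gM'.
(* Here [f] is the coloop and [e] the loop, so the same construction applies with the two
   exchanged. *)
rewrite eq_sym in nef.
have [|M' [? ? gM']] := @loop_coloop_minor _ _ _ _ _ nef fM eM fX eX iF.
  by rewrite iE.
by exists M'; rewrite gM' setUC.
Qed.
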